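(* Let $(X,d)$ be a controlled metric type space with control function $\alpha : X\times X\to[1,\infty)$ such that $\sup_{x,y\in X}\alpha(x,y)$ exists (is finite) and equals $k$. Let $r>0$, and let $\{a_n\}_{n\in\mathbb N}$ and $\{b_n\}_{n\in\mathbb N}$ be two sequences in $X$ such that, for some natural number $p_1$, $d(a_i,b_i)\le \frac{r}{k}$ for all $i\ge p_1$. If $\{a_n\}$ converges to $\xi\in X$, then $\{b_n\}$ is $r$-convergent to $\xi$.
   Context: A controlled metric type space is a nonempty set $X$ with functions $\alpha: X\times X\to[1,\infty)$ and $d:X\times X\to[0,\infty)$ such that for all $x,y,z\in X$: $d(x,y)=0$ iff $x=y$; $d(x,y)=d(y,x)$; and $d(x,y)\le \alpha(x,z)d(x,z)+\alpha(z,y)d(z,y)$. (No symmetry of $\alpha$ is assumed.) A sequence $\{x_n\}$ in $X$ converges to $x$ if for every $\varepsilon>0$ there is $K\in\mathbb N$ with $d(x_n,x)<\varepsilon$ for all $n\ge K$. For a real $r\ge0$, $\{x_n\}$ is $r$-convergent (rough convergent of roughness degree $r$) to $x\in X$ if for every $\varepsilon>0$ there is $n_0\in\mathbb N$ with $d(x_n,x)<r+\varepsilon$ for all $n\ge n_0$. *)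

(* Defs.v *)
From Stdlib Require Import Reals.
Local Open Scope R_scope.

(* The control function is not assumed symmetric: the order of the arguments
   of [alpha] in the triangle inequality matters. *)
Record controlled_metric {X : Type} (alpha d : X -> X -> R) : Prop := {
  cm_nonempty : inhabited X;
  cm_alpha_ge1 : forall x y, 1 <= alpha x y;
  cm_dist_ge0 : forall x y, 0 <= d x y;
  cm_dist_eq0 : forall x y, d x y = 0 <-> x = y;
  cm_dist_sym : forall x y, d x y = d y x;
  cm_triangle : forall x y z,
    d x y <= alpha x z * d x z + alpha z y * d z y
}.

Definition converges_to {X : Type} (d : X -> X -> R) (x : nat -> X) (l : X)
  : Prop :=
  forall eps, 0 < eps ->
    exists K : nat, forall n : nat, (K <= n)%nat -> d (x n) l < eps.

Definition rough_converges_to {X : Type} (d : X -> X -> R) (r : R)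
  (x : nat -> X) (l : X) : Prop :=
  forall eps, 0 < eps ->
    exists n0 : nat, forall n : nat, (n0 <= n)%nat -> d (x n) l < r + eps.

(* Main.v *)
Require Import Defs.
From Stdlib Require Import Reals.
From Stdlib Require Import Lra Lia.
Local Open Scope R_scope.

(** A finite bound [k] on [alpha] makes [d] a b-metric with coefficient [k]
    ([controlled_dist_le_bound]). Going from [b n] to [xi] through [a n] then costs at most [k]
    times the sum of two distances: one is eventually at most [r / k], the other eventually below
    [eps / k], so the total is below [r + eps]. *)

(** Since distances are nonnegative, both coefficients of the triangle inequality may be enlarged to
    [k]; the order of the arguments of [alpha] then no longer matters. *)
Lemma controlled_dist_le_bound (X : Type) (alpha d : X -> X -> R) (k : R) :
  controlled_metric alpha d -> (forall x y, alpha x y <= k) ->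
  forall x y z, d x y <= k * (d x z + d z y).
Proof.
  intros Hcm Hle x y z.
  rewrite Rmult_plus_distr_l.
  eapply Rle_trans; [apply (cm_triangle _ _ Hcm x y z)|].
  apply Rplus_le_compat; apply Rmult_le_compat_r;
    auto using (cm_dist_ge0 _ _ Hcm).
Qed.

Theorem theorem3p13 (X : Type) (alpha d : X -> X -> R)
  (Hcm : controlled_metric alpha d)
  (k : R) (Hk : is_lub (fun v : R => exists x y : X, v = alpha x y) k)
  (r : R) (Hr : 0 < r)
  (a b : nat -> X)
  (Hab : exists p1 : nat, forall i : nat, (p1 <= i)%nat -> d (a i) (b i) <= r / k)
  (xi : X) (Ha : converges_to d a xi) :
  rough_converges_to d r b xi.
Proof.
  assert (Hle : forall x y, alpha x y <= k) by (intros x y; apply Hk; eauto).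
  (* Any value of [alpha] gives [1 <= k]; the pair [xi], [xi] is at hand. *)
  assert (Hk0 : 0 < k).
  { pose proof (cm_alpha_ge1 _ _ Hcm xi xi). specialize (Hle xi xi). lra. }
  intros eps Heps.
  destruct Hab as [p1 Hp1].
  (* The tolerance [eps / k] absorbs the factor [k] of the relaxed triangle inequality. *)
  destruct (Ha (eps / k)) as [K HK]; [now apply Rdiv_lt_0_compat|].
  exists (Nat.max p1 K); intros n Hn.
  specialize (Hp1 n ltac:(lia)). specialize (HK n ltac:(lia)).
  rewrite (cm_dist_sym _ _ Hcm) in Hp1.
  eapply Rle_lt_trans;
    [apply (controlled_dist_le_bound _ _ _ _ Hcm Hle _ _ (a n))|].
  replace (r + eps) with (k * (r / k + eps / k)) by (field; lra).
  apply Rmult_lt_compat_l; lra.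
Qed.
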